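(* Let $G=\mathbf{C}(\beta\mathbb{Z}^+,\mathbb{Z})$ be the group of all continuous functions from $\beta\mathbb{Z}^+$ to $\mathbb{Z}$, endowed with the componentwise ordering, and let $u\in G$ be the constant function with value $1$. Let $S$ be the state space of $(G,u)$ and let $\phi\colon G\to\mathrm{Aff}(S)$ be the natural map. Then $G$ is a Dedekind complete $\ell$-group, but there exist an affine upper semicontinuous function $p\colon S\to\mathbb{R}^+$ and an affine continuous function $q\colon S\to\mathbb{R}^+$ such that $p\leq q$ and $p(s)\in s[G]$ for all $s\in\partial_{\mathrm{e}}S$, but such that there exists no $x\in G$ with $p\leq\phi(x)\leq q$.
   Context: $\mathbb{Z}^+$ is the set of non-negative integers and $\beta\mathbb{Z}^+$ is the Čech–Stone compactification of the discrete space $\mathbb{Z}^+$ (the space of all ultrafilters on $\mathbb{Z}^+$). An $\ell$-group is a lattice-ordered group. The state space $S$ of a partially ordered abelian group with order-unit $(G,u)$ is the set of all positive (order-preserving) group homomorphisms $s\colon G\to\mathbb{R}$ with $s(u)=1$, a compact convex subset of $\mathbb{R}^G$ (product topology); $\partial_{\mathrm{e}}S$ is its set of extreme points, and $s[G]=\{s(x):x\in G\}$. $\mathrm{Aff}(S)$ is the group of affine continuous functions $S\to\mathbb{R}$, and $\phi(x)(s)=s(x)$. Inequalities between functions are pointwise. *)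

(* Defs.v *)
From HB Require Import structures.
From mathcomp Require Import all_boot all_order all_algebra.
From mathcomp Require Import all_classical all_reals all_analysis.

Set Implicit Arguments.
Unset Strict Implicit.
Unset Printing Implicit Defensive.

Import Order.TTheory GRing.Theory Num.Theory.
Import numFieldNormedType.Exports.

Local Open Scope classical_set_scope.
Local Open Scope ring_scope.
Local Open Scope convex_scope.

(** The Stone-Cech compactification of the discrete space [nat]: ultrafilters on
    [nat], where the sets [betaN_base A] below, for [A : set nat], form a base
    of the topology. *)
Definition betaN : Type := {F : set_system nat | UltraFilter F}.

HB.instance Definition _ := gen_eqMixin betaN.
HB.instance Definition _ := gen_choiceMixin betaN.

Definition betaN_base (A : set nat) : set betaN := [set F | sval F A].

Lemma betaN_base_cover : \bigcup_(A in [set: set nat]) betaN_base A = setT.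
Proof.
rewrite -subTset => F _; exists setT => //.
have := svalP F => FU; exact: filterT.
Qed.

Lemma betaN_base_join (A B : set nat) (F : betaN) : setT A -> setT B ->
  betaN_base A F -> betaN_base B F ->
  exists C, [/\ setT C, betaN_base C F &
                betaN_base C `<=` betaN_base A `&` betaN_base B].
Proof.
move=> _ _ FA FB; exists (A `&` B); split => //.
  have := svalP F => FU; exact: filterI.
move=> F' F'AB; have := svalP F' => F'U.
by split; apply: filterS F'AB => n [].
Qed.

HB.instance Definition _ :=
  isBaseTopological.Build betaN betaN_base_cover betaN_base_join.

(** [Cint X] is the group C(X, Z) with the pointwise operations and order. *)
Section Cint.
Variable X : topologicalType.

Definition Cint_pred : {pred X -> int} :=
  fun f => `[< continuous (f : X -> discrete_topology int) >].

Lemma Cint_zmod_closed : zmod_closed Cint_pred.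
Proof.
have cont (f : X -> discrete_topology int) (x : X) :
    {for x, continuous f} <-> \forall y \near x, f y = f x.
  by rewrite /continuous_at; apply: discrete_cvg.
split=> [|f g /asboolP cf /asboolP cg]; apply/asboolP => x.
  by apply/cont; exact: nearW.
have /cont cfx := cf x; have /cont cgx := cg x; apply/cont.
near=> y; rewrite /GRing.add /GRing.opp /=.
have -> : f y = f x by near: y.
by have -> : g y = g x by near: y.
Unshelve. all: by end_near. Qed.

HB.instance Definition _ :=
  GRing.isZmodClosed.Build (X -> int) Cint_pred Cint_zmod_closed.

Record Cint : Type :=
  MkCint { Cint_fun :> X -> int ; Cint_funP : Cint_fun \in Cint_pred }.

HB.instance Definition _ := [isSub for Cint_fun].
HB.instance Definition _ := [Choice of Cint by <:].
HB.instance Definition _ := [SubChoice_isSubZmodule of Cint by <:].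
HB.instance Definition _ :=
  [SubChoice_isSubPOrder of Cint by <: with ring_display].

Lemma cst_Cint (k : int) : cst k \in Cint_pred.
Proof. by apply/asboolP => x; exact: cvg_cst. Qed.

Definition Cint_cst (k : int) : Cint := MkCint (cst_Cint k).

Lemma Cint_leP (f g : Cint) : (f <= g) <-> (forall x, f x <= g x).
Proof. by split=> [/lefP|?]; [exact | apply/lefP]. Qed.

End Cint.

(** A [porderZmodType] carries no compatibility between its order and its
    addition, hence the first clause. *)
Definition is_lgroup (G : porderZmodType) : Prop :=
  (forall x y z : G, x <= y -> x + z <= y + z) /\
  (forall x y : G,
     supremums [set x; y] !=set0 /\ infimums [set x; y] !=set0).

Definition dedekind_complete (G : porderZmodType) : Prop :=
  forall A : set G, has_sup A -> supremums A !=set0.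

Section Convexity.
Variable R : realType.

Definition affine (T U : convType R) (f : T -> U) : Prop :=
  forall (t : {i01 R}) (x y : T), f (x <| t |> y) = f x <| t |> f y.

Definition extreme_points (T : convType R) : set T :=
  [set x | forall (t : {i01 R}) (y z : T), 0 < t%:num < 1 ->
     x = y <| t |> z -> y = x /\ z = x].

End Convexity.

Arguments extreme_points {R T}.

Definition upper_semicontinuous (X : topologicalType) (R : realType)
    (f : X -> R) : Prop :=
  forall x a, f x < a -> \forall y \near x, f y < a.

Section StateSpace.
Variables (R : realType) (G : porderZmodType) (u : G).

Definition states : set {ptws G -> R} :=
  [set s | [/\ zmod_morphism (s : G -> R), {homo s : x y / x <= y} &
               s u = 1]].

(** An alias of the subtype of [states], so that it can be given a convex
    structure; its topology is the one induced by the product topology. *)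
Definition state_space : Type := set_type states.

HB.instance Definition _ := Topological.on state_space.

Definition state_fun (s : state_space) : G -> R := set_val s.

Coercion state_fun : state_space >-> Funclass.

Lemma state_inj (s t : state_space) : s =1 t -> s = t.
Proof. by move=> st; apply: val_inj; apply/funext. Qed.

Lemma stateB (s : state_space) : zmod_morphism s.
Proof. by have [] := set_valP s. Qed.

Lemma state_homo (s : state_space) : {homo s : x y / x <= y}.
Proof. by have [] := set_valP s. Qed.

Lemma state1 (s : state_space) : s u = 1.
Proof. by have [] := set_valP s. Qed.

Lemma state_conv_subproof (t : {i01 R}) (x y : state_space) :
  (fun g => t%:num * x g + (1 - t%:num) * y g) \in states.
Proof.
apply/mem_set; split=> [a b|a b ab|].
- by rewrite !stateB !mulrBr opprD !addrA; congr (_ + _); rewrite addrAC.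
- by rewrite lerD// ler_wpM2l ?subr_ge0 ?state_homo.
- by rewrite !state1 !mulr1 addrC subrK.
Qed.

Definition state_conv (t : {i01 R}) (x y : state_space) : state_space :=
  SigSub (state_conv_subproof t x y).

(** Forgetting that a state is a state embeds [state_space] in the convex space
    of all functions, from which the convex space axioms are inherited. *)
Let emb (s : state_space) : convex_lmodType (G -> R) := state_fun s.

Let emb_conv t x y : emb (state_conv t x y) = emb x <| t |> emb y.
Proof. by []. Qed.

Let emb_inj : injective emb.
Proof. by move=> x y xy; apply: state_inj => g; exact: (congr1 (@^~ g) xy). Qed.

Let state_conv1 x y : state_conv 1%:i01 x y = x.
Proof. by apply: emb_inj; rewrite emb_conv conv1. Qed.

Let state_convmm t x : state_conv t x x = x.
Proof. by apply: emb_inj; rewrite emb_conv convmm. Qed.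

Let state_convC t x y : state_conv t x y = state_conv (1 - t%:inum)%:i01 y x.
Proof. by apply: emb_inj; rewrite !emb_conv convC. Qed.

Let state_convA : convex_quasi_associative state_conv.
Proof.
move=> p q r s a b c prs spq; apply: emb_inj.
by rewrite !emb_conv; exact: convA.
Qed.

HB.instance Definition _ := isConvexSpace.Build R state_space
  state_conv1 state_convmm state_convC state_convA.

Lemma state_convE (t : {i01 R}) (x y : state_space) (g : G) :
  (x <| t |> y : state_space) g = t%:num * x g + (1 - t%:num) * y g.
Proof. by []. Qed.

Definition Aff_pred : {pred state_space -> R} :=
  fun f => `[< affine (f : state_space -> R^o) /\ continuous f >].

Lemma Aff_zmod_closed : zmod_closed Aff_pred.
Proof.
split=> [|f g /asboolP[af cf] /asboolP[ag cg]]; apply/asboolP; split.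
- by move=> t x y; exact: esym (convmm t (0 : R^o)).
- by move=> x; exact: (@cst_continuous _ _ 0).
- move=> t x y; rewrite /GRing.add /GRing.opp /= af ag !convRE.
  rewrite !mulrBr opprD !addrA; congr (_ + _); by rewrite addrAC.
- by move=> x; apply: (@cvgB R R^o _ (nbhs x) _ f g); [exact: cf | exact: cg].
Qed.

HB.instance Definition _ :=
  GRing.isZmodClosed.Build (state_space -> R) Aff_pred Aff_zmod_closed.

Record Aff : Type :=
  MkAff { Aff_fun :> state_space -> R ; Aff_funP : Aff_fun \in Aff_pred }.

HB.instance Definition _ := [isSub for Aff_fun].
HB.instance Definition _ := [Choice of Aff by <:].
HB.instance Definition _ := [SubChoice_isSubZmodule of Aff by <:].

Lemma eval_Aff (x : G) : (fun s : state_space => s x) \in Aff_pred.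
Proof.
apply/asboolP; split => // s.
apply: (@continuous_comp _ _ _ set_val (fun f : {ptws G -> R} => f x)).
  exact: initial_continuous.
exact: (@proj_continuous G (fun=> R) x).
Qed.

Definition natural_map (x : G) : Aff := MkAff (eval_Aff x).

End StateSpace.

(* Main.v *)
Require Import Defs.
From mathcomp Require Import all_boot all_order all_algebra.
From mathcomp Require Import all_classical all_reals all_analysis.
From mathcomp Require Import lra zify.

Import Order.TTheory GRing.Theory Num.Theory.
Import numFieldNormedType.Exports.
Local Open Scope classical_set_scope.
Local Open Scope ring_scope.

(** Write [e n] for the indicator of the closure, in the ultrafilter space, of
    the set of naturals [k > n]; these indicators decrease to that of the set
    of free ultrafilters. For a state [s], read as a finitely additive
    probability measure on the natural numbers, put
      [p s = inf_n s (e n)]  and  [q s = \sum_n s (e n) / 2 ^+ n.+1].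
    So [p s] is the mass that [s] gives to the free ultrafilters. As the limit
    of a decreasing sequence of continuous affine functions, [p] is affine and
    upper semicontinuous ([seq_inf_affine], [seq_inf_usc]); as a uniform limit,
    [q] is affine and continuous ([geom_mean_affine],
    [geom_mean_continuous]); and [p <= q] because the weights add up to [1]
    ([seq_inf_le_geom_mean]).

    An extreme state takes only the values [0] and [1] on the [e n]
    ([extreme_idempotent]), so [p] is [0] or [1] there, a value that every state
    takes at [0] or at the order-unit.

    No [x] fits in between. At the principal ultrafilter of [n] the value of
    [q] is below [1], since [e n] vanishes there ([geom_mean_lt1]); the integer
    [x n] is then at most [0], and by density of the natural numbers [x <= 0]
    everywhere ([betaN_le_dense]). But at a free ultrafilter [p] is [1], which
    forces [1 <= x] there.

    Dedekind completeness ([Cint_betaN_dedekind]) holds because a function on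
    the natural numbers lying between two continuous integer-valued functions
    extends continuously to all ultrafilters ([ultra_bounded_cst],
    [betaN_extend]). *)

(** * Integer-valued continuous functions *)

Lemma Cint_predP {X : topologicalType} (f : X -> int) :
  f \in @Cint_pred X <-> forall x, \forall y \near x, f y = f x.
Proof.
split=> [/asboolP cf x|cf].
  by have /discrete_cvg := cf x.
by apply/asboolP => x; apply/discrete_cvg; exact: cf.
Qed.

Lemma Cint_near {X : topologicalType} (f : Cint X) (x : X) :
  \forall y \near x, f y = f x.
Proof. exact: (Cint_predP f).1 (Cint_funP f) x. Qed.

(** Lattice operations and products come at once from this: any operation on the
    discrete space of integers preserves local constancy. *)
Lemma Cint_op2_subproof {X : topologicalType} (op : int -> int -> int)
  (f g : Cint X) : (fun x => op (f x) (g x)) \in @Cint_pred X.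
Proof.
apply/Cint_predP => x; near=> y.
by congr op; near: y; exact: Cint_near.
Unshelve. all: by end_near. Qed.

Definition Cint_op2 {X : topologicalType} op (f g : Cint X) : Cint X :=
  MkCint (Cint_op2_subproof op f g).

Lemma CintB {X : topologicalType} (f g : Cint X) x : (f - g) x = f x - g x.
Proof. by []. Qed.

Lemma CintD {X : topologicalType} (f g : Cint X) x : (f + g) x = f x + g x.
Proof. by []. Qed.

Lemma Cint_inj {X : topologicalType} (f g : Cint X) :
  (forall x, f x = g x) -> f = g.
Proof. by move=> fg; apply: val_inj; apply/funext. Qed.

Lemma Cint_lgroup (X : topologicalType) : is_lgroup (Cint X).
Proof.
split=> [x y z /Cint_leP xy|x y].
  by apply/Cint_leP => t; exact: lerD (xy t) (lexx _).
split.
  exists (Cint_op2 Order.max x y); split=> [z [->|->]|z zub].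
  - by apply/Cint_leP => t /=; rewrite le_max lexx.
  - by apply/Cint_leP => t /=; rewrite le_max lexx orbT.
  apply/Cint_leP => t /=; rewrite ge_max.
  have /Cint_leP -> := zub x (or_introl erefl).
  by have /Cint_leP -> := zub y (or_intror erefl).
exists (Cint_op2 Order.min x y); split=> [z [->|->]|z zlb].
- by apply/Cint_leP => t /=; rewrite ge_min lexx.
- by apply/Cint_leP => t /=; rewrite ge_min lexx orbT.
apply/Cint_leP => t /=; rewrite le_min.
have /Cint_leP -> := zlb x (or_introl erefl).
by have /Cint_leP -> := zlb y (or_intror erefl).
Qed.

(** * The ultrafilter space of the natural numbers *)

#[local] Instance betaN_ultra (F : betaN) : UltraFilter (sval F) := svalP F.

Lemma betaN_nbhsP (F : betaN) (P : set betaN) :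
  nbhs F P <-> exists2 A, sval F A & betaN_base A `<=` P.
Proof.
rewrite nbhsE; split=> [[U [[D _ <-] [A DA FA]] UP]|[A FA AP]].
  by exists A => // F' F'A; apply: UP; exists A.
exists (betaN_base A) => //; split=> //.
by exists [set A] => //; rewrite bigcup_set1.
Qed.

Definition betaN_pt (n : nat) : betaN :=
  exist _ (principal_filter n) (principal_filter_ultra n).

Lemma betaN_base_pt A n : A n -> betaN_base A (betaN_pt n).
Proof. by move=> An; exact/principal_filterP. Qed.

(** Both sides are locally constant, so they agree near an ultrafilter with
    their values at the points of one of its members. *)
Lemma betaN_le_dense (f g : Cint betaN) :
  (forall n, f (betaN_pt n) <= g (betaN_pt n)) -> f <= g.
Proof.
move=> fg; apply/Cint_leP => F.
have [A FA Afg] :=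
  (betaN_nbhsP _ _).1 (filterI (Cint_near f F) (Cint_near g F)).
have [n An] := filter_ex FA.
by have [/= <- <-] := Afg _ (betaN_base_pt _ _ An).
Qed.

(** An ultrafilter that contains a finite union contains one of its terms, here
    one of the [m] level sets of [h]. *)
Lemma ultra_bounded_cst (h : nat -> int) (F : betaN) (a : int) (m : nat) :
  sval F [set n | a <= h n < a + m%:Z] -> exists k, sval F [set n | h n = k].
Proof.
elim: m => [|m IHm] Fh.
  by have [n /=] := filter_ex Fh; rewrite addr0 => /andP[/le_lt_trans /[apply]];
     rewrite ltxx.
have [|Fn] := in_ultra_setVsetC [set n | h n = a + m%:Z] (betaN_ultra F).
  by exists (a + m%:Z).
apply: IHm; apply: filterS (filterI Fh Fn) => n [/=].
by move=> /andP[h1 h2] /eqP h3; lia.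
Qed.

(** The value of the extension at [F] is the constant value of [h] on a member
    of [F]. *)
Lemma betaN_extend (h : nat -> int) :
  (forall F : betaN, exists k, sval F [set n | h n = k]) ->
  exists H : Cint betaN, forall n, H (betaN_pt n) = h n.
Proof.
move=> /choice[H HP].
have HE (F : betaN) k : sval F [set n | h n = k] -> H F = k.
  by move=> Fk; have [n [/= <- <-]] := filter_ex (filterI (HP F) Fk).
have Hc : H \in @Cint_pred betaN.
  apply/Cint_predP => F; apply/betaN_nbhsP.
  by exists [set n | h n = H F] => // F'; exact: HE.
by exists (MkCint Hc) => n; apply: HE; exact/principal_filterP.
Qed.

Lemma int_max (A : set int) (b : int) : A !=set0 -> ubound A b ->
  exists2 m, A m & ubound A m.
Proof.
move=> [a Aa] Ab.
have ex : exists n : nat, `[< A (b - n%:Z) >].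
  exists `|b - a|%N; apply/asboolP; have := Ab _ Aa => ab.
  by rewrite (_ : b - _ = a)//; lia.
case: (ex_minnP ex) => n /asboolP An nmin.
exists (b - n%:Z) => // c Ac; have cb := Ab _ Ac.
have /nmin : `[< A (b - `|b - c|%N%:Z) >].
  by apply/asboolP; rewrite (_ : b - _ = c)//; lia.
lia.
Qed.

(** The supremum is the extension to all ultrafilters of the supremum [h] taken
    pointwise on the natural numbers. Any element [f0] of the set and any upper
    bound [b] are constant near an ultrafilter, which bounds [h] on one of its
    members. *)
Lemma Cint_betaN_dedekind : dedekind_complete (Cint betaN).
Proof.
move=> A [[f0 Af0] [b Ab]].
have bE f F : A f -> f F <= b F by move=> /Ab/Cint_leP.
have /choice[h hP] n : exists m, [set f (betaN_pt n) | f in A] m /\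
    ubound [set f (betaN_pt n) | f in A] m.
  have [||m] := @int_max [set f (betaN_pt n) | f in A] (b (betaN_pt n)).
  - by exists (f0 (betaN_pt n)); exists f0.
  - by move=> _ [f Af <-]; exact: bE.
  by exists m.
have [F|H HE] := betaN_extend h.
  have [B FB Bfb] :=
    (betaN_nbhsP _ _).1 (filterI (Cint_near f0 F) (Cint_near b F)).
  apply: (@ultra_bounded_cst h F (f0 F) (absz (b F - f0 F + 1))).
  apply: filterS FB => n Bn /=; have [/= <- <-] := Bfb _ (betaN_base_pt _ _ Bn).
  have [[f Af fh] hub] := hP n.
  have f0h : f0 (betaN_pt n) <= h n by apply: hub; exists f0.
  have hb : h n <= b (betaN_pt n) by rewrite -fh; exact: bE.
  by apply/andP; split=> //; lia.
exists H; split=> [f Af|g gub]; apply: betaN_le_dense => n; rewrite HE.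
  by apply: (hP n).2; exists f.
by have [[f Af <-] _] := hP n; have /Cint_leP := gub f Af.
Qed.

(** The indicator of the clopen set [betaN_base A]. *)
Definition betaN_ind_fun (A : set nat) (F : betaN) : int :=
  if `[< sval F A >] then 1 else 0.

Lemma betaN_ind_subproof A : betaN_ind_fun A \in @Cint_pred betaN.
Proof.
apply/Cint_predP => F; apply/betaN_nbhsP; rewrite /betaN_ind_fun.
case: asboolP => FA; first by exists A => // F' F'A; rewrite asboolT.
have [//|FnA] := in_ultra_setVsetC A (betaN_ultra F).
exists (~` A) => // F' F'nA; rewrite asboolF// => F'A.
by have [n [/= nAn An]] := filter_ex (filterI F'nA F'A).
Qed.

Definition betaN_ind A : Cint betaN := MkCint (betaN_ind_subproof A).

(** Any ultrafilter refining the cofinite filter is free. *)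
Lemma betaN_free : exists F : betaN, forall n, sval F [set k | (n <= k)%N].
Proof.
have [F [FU Foo]] := @ultraFilterLemma _ \oo eventually_filter.
by exists (exist _ F FU) => n; apply: Foo; exact: nbhs_infty_ge.
Qed.

(** * Sums and uniform limits of continuous functions *)

(** The partial sums of [q] have this form. As the group has only integer
    multiples, they are not evaluations at elements of the group. *)
Lemma sum_continuous {R : realType} {T : topologicalType} (f : nat -> T -> R)
    (c : nat -> R) N : (forall n, continuous (f n)) ->
  continuous (fun t => \sum_(n < N) f n t * c n).
Proof.
move=> fc; elim: N => [|N IHN] s.
  under eq_fun do rewrite big_ord0.
  exact: cvg_cst.
under eq_fun do rewrite big_ord_recr /=.
apply: (@cvgD R R^o); first exact: IHN.
by apply: (@cvgM R); [exact: fc|exact: cvg_cst].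
Qed.

Lemma approx_continuous {R : realType} {T : topologicalType} (f : T -> R) :
  (forall d, 0 < d -> exists2 g : T -> R, continuous g &
     forall t, `|f t - g t| < d) ->
  continuous f.
Proof.
move=> fg s; apply/cvgrPdist_lt => d d0.
have d30 : 0 < d / 3 by rewrite divr_gt0.
have [g gc fgd] := fg _ d30.
near=> t.
have : `|g s - g t| < d / 3.
  by near: t; have /cvgrPdist_lt := gc s; exact.
have := fgd s; have := fgd t; rewrite !ltr_norml.
move=> /andP[? ?] /andP[? ?] /andP[? ?].
by apply/andP; split; lra.
Unshelve. all: by end_near. Qed.

(** * States *)

Section States.
Context {R : realType}.

Section General.
Context {G : porderZmodType} {u : G}.
Implicit Types s t : state_space R u.

Lemma state0 s : s 0 = 0.
Proof. by rewrite -(subrr 0) stateB subrr. Qed.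

Lemma stateN s x : s (- x) = - s x.
Proof. by rewrite -(sub0r x) stateB state0 sub0r. Qed.

Lemma stateD s x y : s (x + y) = s x + s y.
Proof. by rewrite -{1}(opprK y) stateB stateN opprK. Qed.

Lemma state_ge0 s x : 0 <= x -> 0 <= s x.
Proof. by move=> /(state_homo s); rewrite state0. Qed.

Lemma state_le1 s x : x <= u -> s x <= 1.
Proof. by move=> /(state_homo s); rewrite state1. Qed.

Lemma state_cvg s x : (fun t : state_space R u => t x) @ s --> s x.
Proof.
have /asboolP[_ cx] := eval_Aff R u x; exact: cx.
Qed.
End General.

Section Evaluation.
Context {X : topologicalType}.
Let u := Cint_cst X 1.

Lemma eval_state_subproof (x : X) :
  ((fun f : Cint X => (f x)%:~R) : {ptws Cint X -> R}) \in @states R _ u.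
Proof.
apply/mem_set; split=> [f g|f g /Cint_leP fg|//].
  by rewrite CintB intrB.
by rewrite ler_int.
Qed.

Definition eval_state (x : X) : state_space R u :=
  SigSub (eval_state_subproof x).

Lemma eval_stateE x f : eval_state x f = (f x)%:~R.
Proof. by []. Qed.

Section Cut.
Variables (s : state_space R u) (e : Cint X).
Hypothesis e01 : forall x, e x = 0 \/ e x = 1.
Hypothesis se : 0 < s e.

(** For the measure [s], this is [s] conditioned on the clopen set with
    indicator [e]. *)
Let cut (f : Cint X) : R := s (Cint_op2 *%R f e) / s e.

Lemma cut_subproof : (cut : {ptws Cint X -> R}) \in @states R _ u.
Proof.
apply/mem_set; split=> [f g|f g /Cint_leP fg|].
- rewrite /cut -mulrBl -stateB; congr (s _ / _).
  by apply: Cint_inj => x; rewrite CintB /= mulrBl.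
- rewrite /cut ler_wpM2r ?invr_ge0 ?(ltW se)//; apply: state_homo.
  apply/Cint_leP => x /=; rewrite ler_wpM2r//.
  by case: (e01 x) => ->.
rewrite /cut (_ : Cint_op2 _ _ _ = e) ?divff ?gt_eqF//.
by apply: Cint_inj => x /=; rewrite mul1r.
Qed.

Definition cut_state : state_space R u := SigSub cut_subproof.

Lemma cut_stateE f : cut_state f = s (Cint_op2 *%R f e) / s e.
Proof. by []. Qed.
End Cut.

(** Otherwise the state [s] would be the proper convex combination, with weight
    [s e], of its conditionings on [e] and on the complement of [e]; if the
    first of these is [s] itself, then [s e = 1]. *)
Lemma extreme_idempotent (s : state_space R u) (e : Cint X) :
  extreme_points s -> (forall x, e x = 0 \/ e x = 1) -> s e = 0 \/ s e = 1.
Proof.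
move=> sx e01; have e01' x : (u - e) x = 0 \/ (u - e) x = 1.
  by rewrite CintB /=; case: (e01 x) => ->; [right|left].
have e_ge0 : 0 <= e by apply/Cint_leP => x; case: (e01 x) => ->.
have e_le1 : e <= u by apply/Cint_leP => x; case: (e01 x) => ->.
have s0 : 0 <= s e := state_ge0 s e e_ge0.
have s1 : s e <= 1 := state_le1 s e e_le1.
have [|ne0] := eqVneq (s e) 0; first by left.
have [|ne1] := eqVneq (s e) 1; first by right.
have se : 0 < s e by rewrite lt_neqAle eq_sym ne0.
have suE : s (u - e) = 1 - s e by rewrite stateB state1.
have sue : 0 < s (u - e) by rewrite suE subr_gt0 lt_neqAle ne1.
have [||cs _] := sx (Itv01 s0 s1) (cut_state s e e01 se)
                                  (cut_state s (u - e) e01' sue).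
- by rewrite /= se lt_neqAle ne1.
- apply: state_inj => f; rewrite state_convE !cut_stateE /= -suE.
  rewrite ![_ * (_ / _)]mulrC !divfK ?gt_eqF// -stateD; congr (s _).
  by apply: Cint_inj => x; rewrite CintD /= -mulrDr addrC subrK mulr1.
right; have <- : cut_state s e e01 se e = s e by rewrite cs.
rewrite cut_stateE (_ : Cint_op2 _ _ _ = e) ?divff//.
by apply: Cint_inj => x /=; case: (e01 x) => ->.
Qed.

End Evaluation.

Section DecreasingSequence.
Local Open Scope convex_scope.
Context {G : porderZmodType} {u : G}.
Variable e : nat -> G.
Hypotheses (e_ge0 : forall n, 0 <= e n) (e_le1 : forall n, e n <= u)
  (e_noninc : forall n, e n.+1 <= e n).
Local Notation S := (state_space R u).
Implicit Types s t : S.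

Definition seq_inf s : R := limn (fun n => s (e n)).

Lemma state_seq_noninc s : nonincreasing_seq (fun n => s (e n)).
Proof. by apply/nonincreasing_seqP => n; exact: state_homo. Qed.

Lemma state_seq_cvg s : (fun n => s (e n)) @ \oo --> seq_inf s.
Proof.
apply: nonincreasing_is_cvgn; first exact: state_seq_noninc.
by exists 0 => _ [n _ <-]; exact: state_ge0.
Qed.

Lemma seq_inf_le s n : seq_inf s <= s (e n).
Proof.
by apply: nonincreasing_cvgn_ge; [exact: state_seq_noninc|exact: state_seq_cvg].
Qed.

Lemma seq_inf_ge s c : (forall n, c <= s (e n)) -> c <= seq_inf s.
Proof.
by move=> cs; apply: limr_ge; [exact: state_seq_cvg|exact: nearW].
Qed.

Lemma seq_inf_affine : affine (seq_inf : S -> R^o).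
Proof.
move=> t x y; apply/cvg_lim => //; rewrite convRE.
apply: (@cvgD R R^o); apply: (@cvgM R).
all: by [apply: cvg_cst|exact: state_seq_cvg].
Qed.

(** A strict upper bound of the infimum is already one of some [s (e n)], which
    is continuous in [s] and dominates the infimum. *)
Lemma seq_inf_usc : upper_semicontinuous seq_inf.
Proof.
move=> s a sa.
have [n sna] : exists n, state_fun s (e n) < a.
  by have /cvgr_lt/(_ _ sa)/filter_ex := state_seq_cvg s.
near=> t; apply: le_lt_trans (seq_inf_le t n) _.
by near: t; have /cvgr_lt := state_cvg s (e n); exact.
Unshelve. all: by end_near. Qed.

Definition geom_partial (N : nat) s : R := \sum_(n < N) s (e n) / 2 ^+ n.+1.

Definition geom_mean s : R := limn (geom_partial ^~ s).

Lemma geom_partialS N s :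
  geom_partial N.+1 s = geom_partial N s + s (e N) / 2 ^+ N.+1.
Proof. by rewrite /geom_partial big_ord_recr. Qed.

Lemma geom_partial_nondec s : nondecreasing_seq (geom_partial ^~ s).
Proof.
apply/nondecreasing_seqP => N; rewrite geom_partialS lerDl.
by rewrite divr_ge0 ?state_ge0 ?exprn_ge0.
Qed.

Lemma geom_tailE (N : nat) : (2 ^+ N)^-1 = (2 ^+ N.+1)^-1 + (2 ^+ N.+1)^-1 :> R.
Proof. by rewrite [LHS]splitr exprSr invfM mulrC. Qed.

Lemma half_pow_lt (d : R) : 0 < d -> exists N : nat, (2 ^+ N)^-1 < d.
Proof.
move=> d0; exists (Num.bound d^-1).
by rewrite invf_plt ?posrE ?exprn_gt0// upper_nthrootP.
Qed.

(** All terms are at most the weights, so adding the remaining weight [2 ^- N]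
    to the partial sum gives an upper estimate of the limit that improves with
    [N]. *)
Lemma geom_upper_noninc s :
  nonincreasing_seq (fun N => geom_partial N s + (2 ^+ N)^-1).
Proof.
apply/nonincreasing_seqP => N; rewrite geom_partialS (geom_tailE N) addrA.
rewrite lerD2r lerD2l.
by rewrite ler_piMl ?state_le1 ?invr_ge0 ?exprn_ge0.
Qed.

Lemma geom_partial_cvg s : geom_partial ^~ s @ \oo --> geom_mean s.
Proof.
apply: nondecreasing_is_cvgn; first exact: geom_partial_nondec.
exists 1 => _ [N _ <-].
have := geom_upper_noninc s 0 N (leq0n N).
rewrite {2}/geom_partial big_ord0 expr0 invr1 add0r; apply: le_trans.
by rewrite lerDl invr_ge0 exprn_ge0.
Qed.

Lemma geom_mean_ge N s : geom_partial N s <= geom_mean s.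
Proof.
apply: (nondecreasing_cvgn_le (u_ := geom_partial ^~ s)).
  exact: geom_partial_nondec.
exact: geom_partial_cvg.
Qed.

Lemma geom_mean_le N s : geom_mean s <= geom_partial N s + (2 ^+ N)^-1.
Proof.
apply: limr_le; first exact: geom_partial_cvg.
exists N => // M NM /=; apply: le_trans (geom_upper_noninc s _ _ NM).
by rewrite lerDl invr_ge0 exprn_ge0.
Qed.

Lemma geom_mean_ge0 s : 0 <= geom_mean s.
Proof. by have := geom_mean_ge 0 s; rewrite /geom_partial big_ord0. Qed.

(** The weight of the vanishing term is lost from the total weight [1]. *)
Lemma geom_mean_lt1 s n : s (e n) = 0 -> geom_mean s < 1.
Proof.
move=> sn; apply: le_lt_trans (geom_mean_le n.+1 s) _.
rewrite geom_partialS sn mul0r addr0.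
have := geom_upper_noninc s 0 n (leq0n n).
rewrite {2}/geom_partial big_ord0 expr0 invr1 add0r; apply: lt_le_trans.
by rewrite ltrD2l (geom_tailE n) ltrDl invr_gt0 exprn_gt0.
Qed.

(** Every term is at least the infimum, and the first [N] weights add up to
    [1 - 2 ^- N]. *)
Lemma seq_inf_le_geom_mean s : seq_inf s <= geom_mean s.
Proof.
have lo N : seq_inf s * (1 - (2 ^+ N)^-1) <= geom_partial N s.
  elim: N => [|N IHN].
    by rewrite /geom_partial big_ord0 expr0 invr1 subrr mulr0.
  have h : 0 <= (2 ^+ N.+1)^-1 :> R by rewrite invr_ge0 exprn_ge0.
  have := ler_wpM2r h (seq_inf_le s N).
  rewrite geom_partialS; move: IHN; rewrite (geom_tailE N); nra.
rewrite leNgt -subr_gt0; apply/negP => /half_pow_lt[N].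
have := le_trans (seq_inf_le s 0) (state_le1 s _ (e_le1 0)).
have := seq_inf_ge s 0 (fun n => state_ge0 s _ (e_ge0 n)).
have := le_trans (lo N) (geom_mean_ge N s).
have : 0 < (2 ^+ N)^-1 :> R by rewrite invr_gt0 exprn_gt0.
by move: (2 ^+ N)^-1 => h; nra.
Qed.

Lemma geom_mean_affine : affine (geom_mean : S -> R^o).
Proof.
move=> t x y; apply/cvg_lim => //; rewrite convRE.
have -> : geom_partial ^~ (x <| t |> y : S) =
   fun N => t%:num * geom_partial N x + (1 - t%:num) * geom_partial N y.
  apply/funext => N; rewrite /geom_partial !mulr_sumr -big_split /=.
  by apply: eq_bigr => n _; rewrite state_convE mulrDl !mulrA.
apply: (@cvgD R R^o); apply: (@cvgM R).
all: by [apply: cvg_cst|exact: geom_partial_cvg].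
Qed.

(** The partial sums converge uniformly on the state space: the [N]-th one is
    within [2 ^- N] of the limit. *)
Lemma geom_mean_continuous : continuous geom_mean.
Proof.
apply: approx_continuous => d /half_pow_lt[N Nd]; exists (geom_partial N).
  apply: (@sum_continuous R S (fun n t => state_fun t (e n))
            (fun n => (2 ^+ n.+1)^-1) N) => n s.
  exact: state_cvg.
move=> t; apply: le_lt_trans Nd; rewrite ger0_norm ?subr_ge0 ?geom_mean_ge//.
by rewrite lerBlDl geom_mean_le.
Qed.

Lemma geom_mean_Aff : geom_mean \in @Aff_pred R G u.
Proof.
by apply/asboolP; split; [exact: geom_mean_affine|exact: geom_mean_continuous].
Qed.

End DecreasingSequence.
End States.

Theorem mainTheorem2 (R : realType) :
  let G := Cint betaN in
  let u : G := Cint_cst betaN 1 in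
  let S := state_space R u in
  let phi : G -> Aff R u := natural_map R u in
  is_lgroup G /\ dedekind_complete G /\
  exists (p : S -> R) (q : Aff R u),
    [/\ affine (p : S -> R^o) /\ upper_semicontinuous p,
        (forall s : S, 0 <= p s) /\ (forall s : S, 0 <= q s),
        forall s : S, p s <= q s,
        forall s : S, extreme_points s -> range (state_fun s) (p s) &
        ~ exists x : G, forall s : S, p s <= phi x s <= q s].
Proof.
move=> G u S phi; split; first exact: Cint_lgroup.
split; first exact: Cint_betaN_dedekind.
(* The inequality is strict so that e n vanishes at the point n. *)
pose e n : G := betaN_ind [set k | (n < k)%N].
have e01 n F : e n F = 0 \/ e n F = 1.
  by rewrite /= /betaN_ind_fun; case: asboolP; [right|left].
have e_ge0 n : 0 <= e n by apply/Cint_leP => F; case: (e01 n F) => ->.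
have e_le1 n : e n <= u by apply/Cint_leP => F; case: (e01 n F) => ->.
have e_noninc n : e n.+1 <= e n.
  apply: betaN_le_dense => m; rewrite /= /betaN_ind_fun.
  case: asboolP => [/principal_filterP/= nm|_]; last by case: asboolP.
  by rewrite asboolT//; apply/principal_filterP; exact: ltnW.
exists (seq_inf e), (MkAff (geom_mean_Aff e e_ge0 e_le1)); split => /=.
- split; first exact: seq_inf_affine.
  exact: seq_inf_usc.
- split=> s; last exact: geom_mean_ge0.
  by apply: seq_inf_ge => // n; exact: state_ge0.
- by move=> s; exact: seq_inf_le_geom_mean.
- move=> s sx; have se01 n := extreme_idempotent s (e n) sx (e01 n).
  have [[n sn0]|sn] := pselect (exists n, state_fun s (e n) = 0).
    exists 0 => //; rewrite state0; apply/eqP; rewrite eq_le; apply/andP; split.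
      by apply: seq_inf_ge => // k; exact: state_ge0.
    by rewrite -sn0; exact: seq_inf_le.
  have sn1 n : state_fun s (e n) = 1.
    by case: (se01 n) => // sn0; case: sn; exists n.
  exists u => //; rewrite state1; apply/eqP; rewrite eq_le; apply/andP; split.
    by apply: seq_inf_ge => // k; rewrite sn1.
  by rewrite -(sn1 0); exact: seq_inf_le.
move=> [x px].
have xle0 : x <= Cint_cst betaN 0.
  apply: betaN_le_dense => n /=.
  have /andP[_ xq] := px (eval_state (betaN_pt n)).
  have q1 : geom_mean e (eval_state (betaN_pt n) : S) < 1.
    apply: (geom_mean_lt1 _ _ _ _ n) => //.
    rewrite eval_stateE /= /betaN_ind_fun asboolF//.
    by move=> /principal_filterP/=; rewrite ltnn.
  by have := le_lt_trans xq q1; rewrite /= eval_stateE ltrz1; lia.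
have [F Ffree] := betaN_free.
have /andP[px1 _] := px (eval_state F).
have p1 : 1 <= seq_inf e (eval_state F : S).
  apply: seq_inf_ge => // n.
  by rewrite eval_stateE /= /betaN_ind_fun asboolT//; exact: (Ffree n.+1).
have := le_trans p1 px1; rewrite /= eval_stateE ler1z => x1.
by have /Cint_leP/(_ F)/= := xle0; rewrite leNgt; lia.
Qed.
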